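(* Let $\mathcal{L}$ be a positive-definite linear functional, let $d\mu$ be the corresponding measure, that is, $\mathcal{L}[p]=\int_{\mathbb{R}}p(x)\,d\mu(x)$ for all polynomials $p$, and let $\{P_n(z)\}_{n=0}^\infty$ be the monic OPS with respect to $\mathcal{L}$. Let $\kappa_1,\kappa_2\in\mathbb{C}\setminus\mathbb{R}$ lie in opposite open half-planes (i.e. $\kappa_1\in\mathbb{C}_{\pm}$ and $\kappa_2\in\mathbb{C}_{\mp}$). Then the monic OPS $\{P_n^{**}(\kappa_1,\kappa_2,z)\}_{n=0}^\infty$ with respect to the functional $\mathcal{L}^{**}[p(z)]=\mathcal{L}[(z-\kappa_2)(z-\kappa_1)p(z)]$ exists. Equivalently, the complex measure $(x-\kappa_1)(x-\kappa_2)\,d\mu(x)$ generates a system of monic orthogonal polynomials $P_n^{**}(\kappa_1,\kappa_2,z)$ and thus a monic Jacobi matrix $J_m^{**}(\kappa_1,\kappa_2)$. In particular, $$\Delta_n(\kappa_1,\kappa_2)=\begin{vmatrix}P_{n+1}(\kappa_1)&P_n(\kappa_1)\\P_{n+1}(\kappa_2)&P_n(\kappa_2)\end{vmatrix}\neq0,\quad n=0,1,2,\dots,$$ and $$P_n^{**}(\kappa_1,\kappa_2,z)=\frac{1}{(z-\kappa_1)(z-\kappa_2)}\,\frac{\begin{vmatrix}P_{n+2}(\kappa_1)&P_{n+1}(\kappa_1)&P_n(\kappa_1)\\P_{n+2}(\kappa_2)&P_{n+1}(\kappa_2)&P_n(\kappa_2)\\P_{n+2}(z)&P_{n+1}(z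)&P_n(z)\end{vmatrix}}{\Delta_n(\kappa_1,\kappa_2)}.$$
   Context: $\mathbb{C}_\pm=\{z\in\mathbb{C}:\pm\operatorname{Im}z>0\}$. A linear functional $\mathcal{L}:\mathbb{C}[z]\to\mathbb{C}$ is positive-definite if $\mathcal{L}[p]>0$ for every polynomial $p$ that is not identically zero and is non-negative on $\mathbb{R}$. A monic orthogonal polynomial system (OPS) with respect to a complex-valued functional $\mathcal{M}$ on $\mathbb{C}[z]$ is a sequence of monic polynomials $p_n$ with $\deg p_n=n$, $\mathcal{M}[p_np_m]=0$ for $n\neq m$, and $\mathcal{M}[p_n^2]\neq0$ for all $n\ge0$. A monic OPS satisfies a recurrence $zp_n=p_{n+1}+c_{n+1}p_n+\lambda_{n+1}p_{n-1}$ with $\lambda_n\neq0$, and its monic Jacobi matrix is the semi-infinite tridiagonal matrix with diagonal $c_1,c_2,\dots$, superdiagonal $1,1,\dots$ and subdiagonal $\lambda_2,\lambda_3,\dots$. *)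

(* Defs.v *)
From HB Require Import structures.
From mathcomp Require Import all_boot all_order all_algebra.
From mathcomp Require Import complex.
From mathcomp Require Import all_classical all_reals all_analysis.

Set Implicit Arguments.
Unset Strict Implicit.
Unset Printing Implicit Defensive.

Import Order.TTheory GRing.Theory Num.Theory.
Import numFieldNormedType.Exports.

Local Open Scope classical_set_scope.
Local Open Scope complex_scope.
Local Open Scope ring_scope.

Definition upper_half_plane (R : realType) : set R[i] :=
  [set z | 0 < complex.Im z].

Definition lower_half_plane (R : realType) : set R[i] :=
  [set z | complex.Im z < 0].

(* In the order of [R[i]], [0 <= z] (resp. [0 < z]) says that [z] is real and
   nonnegative (resp. positive). *)
Definition positive_definite (R : realType)
    (L : {scalar {poly R[i]}}) : Prop :=
  forall p : {poly R[i]}, p != 0 ->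
    (forall x : R, 0 <= p.[x%:C]) -> 0 < L p.

Definition complex_integrable (R : realType)
    (mu : {measure set (measurableTypeR R) -> \bar R}) (f : R -> R[i]) : Prop :=
  mu.-integrable setT (EFin \o (fun x => complex.Re (f x))) /\
  mu.-integrable setT (EFin \o (fun x => complex.Im (f x))).

Definition complex_integral (R : realType)
    (mu : {measure set (measurableTypeR R) -> \bar R}) (f : R -> R[i]) : R[i] :=
  (Rintegral mu setT (fun x => complex.Re (f x)))
  +i* (Rintegral mu setT (fun x => complex.Im (f x))).

Definition represents (R : realType)
    (mu : {measure set (measurableTypeR R) -> \bar R})
    (L : {scalar {poly R[i]}}) : Prop :=
  forall p : {poly R[i]},
    complex_integrable mu (fun x => p.[x%:C]) /\
    L p = complex_integral mu (fun x => p.[x%:C]).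

(* Integration of polynomials against the complex measure [w(x) dmu(x)]. *)
Definition density_functional (R : realType)
    (mu : {measure set (measurableTypeR R) -> \bar R}) (w : R -> R[i])
    (p : {poly R[i]}) : R[i] :=
  complex_integral mu (fun x => p.[x%:C] * w x).

Definition christoffel2 (R : realType) (L : {scalar {poly R[i]}})
    (k1 k2 : R[i]) (p : {poly R[i]}) : R[i] :=
  L (('X - k2%:P) * ('X - k1%:P) * p).

Definition is_monic_OPS (R : realType) (M : {poly R[i]} -> R[i])
    (P : nat -> {poly R[i]}) : Prop :=
  [/\ forall n, P n \is monic,
      forall n, size (P n) = n.+1,
      forall n m, n != m -> M (P n * P m) = 0
    & forall n, M (P n ^+ 2) != 0].

(* Rows and columns are numbered from 0, the recurrence coefficients from 1. *)
Definition tridiagonal (R : realType) (c lam : nat -> R[i]) (i j : nat) : R[i] :=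
  if j == i then c i.+1
  else if j == i.+1 then 1
  else if i == j.+1 then lam i.+1
  else 0.

(* [z p_n = p_{n+1} + c_{n+1} p_n + lambda_{n+1} p_{n-1}] with [p_{-1} = 0]; the
   value of [lambda_1] is therefore immaterial. *)
Definition is_monic_jacobi_matrix (R : realType)
    (P : nat -> {poly R[i]}) (J : nat -> nat -> R[i]) : Prop :=
  exists c lam : nat -> R[i],
    [/\ forall n, lam n.+1 != 0,
        forall n, 'X * P n = P n.+1 + c n.+1 *: P n
                    + lam n.+1 *: (if n is m.+1 then P m else 0)
      & forall i j, J i j = tridiagonal c lam i j].

(* For [zs = (z_0, ..., z_{m-1})], the determinant whose row [i] is
   [P_{n+m-1}(z_i), ..., P_{n+1}(z_i), P_n(z_i)]. *)
Definition shifted_det (R : realType) (P : nat -> {poly R[i]}) (m : nat)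
    (zs : m.-tuple R[i]) (n : nat) : R[i] :=
  \det (\matrix_(i < m, j < m) (P (n + (m.-1 - j))%N).[tnth zs i]).

(* Main.v *)
(* On the real line the weight (x - k1) (x - k2) stays in an open half-plane, so
   M := L[(z - k1) (z - k2) _] satisfies M[r r^*] <> 0 for every r <> 0.  If Delta_n
   vanished, some nonzero combination of P_(n+1) and P_n would equal (z - k1) (z - k2) r
   with deg r < n, and its L-orthogonality to r^* would give M[r r^*] = 0.  Hence the
   Christoffel quotient Q_n of degree n is defined; it is M-orthogonal to lower
   degrees, and M[Q_n^2] = M[Q_n Q_n^*] because Q_n - Q_n^* has degree < n. *)

Require Import Defs.
From HB Require Import structures.
From mathcomp Require Import all_boot all_order all_algebra.
From mathcomp Require Import complex.
From mathcomp Require Import all_classical all_reals all_analysis.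
From mathcomp Require Import ring.

Import Order.TTheory GRing.Theory Num.Theory.

Local Open Scope classical_set_scope.
Local Open Scope complex_scope.
Local Open Scope ring_scope.

(** * Conjugate polynomials and positivity *)

Local Notation conjp := (map_poly (@conjc _)).

Lemma horner_conjp {R : realType} (p : {poly R[i]}) (x : R) :
  (conjp p).[x%:C] = (p.[x%:C])^*.
Proof. by rewrite -{1}(conjc_real x) horner_map. Qed.

(** The integral acts separately on real and imaginary parts, and on the real line conjugation only
    flips the sign of the latter. *)
Lemma represents_conjp {R : realType}
    {mu : {measure set (measurableTypeR R) -> \bar R}} {L : {scalar {poly R[i]}}}
    (mu_L : represents mu L) (p : {poly R[i]}) :
  L (conjp p) = (L p)^*.
Proof.
have [_ ->] := mu_L (conjp p); have [[_ iI] ->] := mu_L p.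
rewrite /complex_integral /=; congr (_ +i* _).
  by congr Rintegral; apply/funext => x; rewrite horner_conjp; case: _.[_].
rewrite -mulN1r -RintegralZl //; congr Rintegral; apply/funext => x.
by rewrite horner_conjp mulN1r; case: _.[_].
Qed.

Lemma positive_definite_norm {R : realType} {L : {scalar {poly R[i]}}}
    (L_pos : positive_definite L) (s : {poly R[i]}) :
  s != 0 -> 0 < L (s * conjp s).
Proof.
move=> s0; apply: L_pos => [|x]; first by rewrite mulf_neq0 // map_poly_eq0.
by rewrite hornerM horner_conjp mul_conjC_ge0.
Qed.

(* With a = x - k1 and b = x - k2, (k1 - k2) (a b)^* = |b|^2 a^* - |a|^2 b^*,
   so Im ((k1 - k2) (a b)^* ) = |b|^2 Im k1 - |a|^2 Im k2 > 0: the weight a b takes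
   its values in a fixed open half-plane. *)
Lemma christoffel2_norm_neq0 {R : realType} {L : {scalar {poly R[i]}}}
    (L_pos : positive_definite L) (L_conj : forall p, L (conjp p) = (L p)^*)
    (k1 k2 : R[i]) (r : {poly R[i]}) :
  upper_half_plane k1 -> lower_half_plane k2 -> r != 0 ->
  christoffel2 L k1 k2 (r * conjp r) != 0.
Proof.
rewrite /upper_half_plane /lower_half_plane /= => k1U k2L r0.
apply/eqP; rewrite /christoffel2; set w := _ * (r * _) => Lw0.
have Lw'0 : L (conjp w) = 0 by rewrite L_conj Lw0 rmorph0.
pose s (k : R[i]) := ('X - k%:P) * r.
have s0 k : s k != 0 by rewrite mulf_neq0 ?polyXsubC_eq0.
have conj_s k : conjp (s k) = ('X - (k^*)%:P) * conjp r.
  by rewrite rmorphM /= map_polyXsubC.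
have conjpK : conjp (conjp r) = r.
  by rewrite -map_poly_comp map_poly_id // => x _; exact: conjcK.
(* Polynomial form of the half-plane identity: 2i times the imaginary part of (k1 - k2) (a b)^*,
   multiplied by r r^*. If [L w = 0], then [L] kills the right side, while the left side gives 2i
   times a positive number. *)
have key : (k1 - k1^*) *: (s k2 * conjp (s k2)) -
           (k2 - k2^*) *: (s k1 * conjp (s k1)) =
           (k1 - k2) *: conjp w - (k1^* - k2^*) *: w.
  rewrite !conj_s /s /w !rmorphM /= !map_polyXsubC /= conjpK -!mul_polyC !polyCB.
  ring.
have := congr1 L key; rewrite !linearB /= ![L (_ *: _)]linearZ /= Lw0 Lw'0 !mulr0 subr0 !subcJ.
set A := L (s k2 * _); set B := L (s k1 * _).
have A0 : 0 < A by exact: positive_definite_norm.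
have B0 : 0 < B by exact: positive_definite_norm.
move=> E.
have : 2 * 'i%C * ((complex.Im k1)%:C * A - (complex.Im k2)%:C * B) = 0.
  by rewrite -E; ring.
move/eqP; rewrite mulf_eq0 mulf_eq0 pnatr_eq0 (negbTE (neq0Ci _)) /=.
apply/negP; rewrite gt_eqF // -mulNr addr_gt0 // mulr_gt0 //.
  by rewrite ltcR.
by rewrite -rmorphN ltcR oppr_gt0.
Qed.

(** * Orthogonality, three-term recurrence and uniqueness *)

Lemma size_sub_monic {F : nzRingType} {n : nat} {p q : {poly F}} :
  p \is monic -> q \is monic -> size p = n.+1 -> size q = n.+1 ->
  (size (p - q)%R <= n)%N.
Proof.
rewrite !monicE !lead_coefE => pm qm sp sq; rewrite sp /= in pm; rewrite sq /= in qm.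
apply/leq_sizeP => j; rewrite coefB leq_eqVlt => /orP[/eqP<-|nj].
  by rewrite (eqP pm) (eqP qm) subrr.
by rewrite !nth_default ?subrr ?sp ?sq.
Qed.

Section OrthogonalPolynomials.
Context {R : realType} {M : {scalar {poly R[i]}}} {P : nat -> {poly R[i]}}.
Hypothesis OPS : is_monic_OPS M P.

Lemma size_sub_OPS (n : nat) (s : {poly R[i]}) :
  (size s <= n.+1)%N -> (size (s - s`_n *: P n)%R <= n)%N.
Proof.
have [Pmon Psz _ _] := OPS => ss; apply/leq_sizeP => j.
rewrite coefB coefZ leq_eqVlt => /orP[/eqP<-|nj].
  by have := Pmon n; rewrite monicE lead_coefE Psz /= => /eqP->; rewrite mulr1 subrr.
by rewrite (nth_default _ (leq_trans ss nj)) [(P n)`_j]nth_default ?Psz // mulr0 subrr.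
Qed.

Lemma OPS_orthogonal (n m : nat) (s : {poly R[i]}) :
  (size s <= m)%N -> (m <= n)%N -> M (P n * s) = 0.
Proof.
have [_ _ Por _] := OPS.
elim: m s => [|m IH] s ss mn.
  by move: ss; rewrite leqn0 size_poly_eq0 => /eqP->; rewrite mulr0 linear0.
rewrite -[s](subrK (s`_m *: P m)) mulrDr linearD /= IH ?size_sub_OPS ?(ltnW mn) //.
by rewrite -scalerAr linearZ /= Por ?mulr0 ?addr0 // gtn_eqF.
Qed.

(** Pairing with the top polynomial P_n returns the coefficient of z^n times M[P_n^2], which is
    nonzero; so the coefficients vanish one by one from the top. No positivity of [M] is
    involved. *)
Lemma OPS_separating (n : nat) (s : {poly R[i]}) :
  (size s <= n)%N -> (forall k, (k < n)%N -> M (s * P k) = 0) -> s = 0.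
Proof.
have [_ _ _ Pnz] := OPS.
elim: n s => [|n IH] s ss sP; first by apply/eqP; rewrite -size_poly_eq0 -leqn0.
have /eqP : M (s * P n) = 0 by apply: sP.
rewrite -{1}[s](subrK (s`_n *: P n)) mulrDl linearD /= mulrC.
rewrite (@OPS_orthogonal n n) ?size_sub_OPS // add0r -scalerAl linearZ /= -expr2.
rewrite mulf_eq0 (negbTE (Pnz n)) orbF => /eqP sn0.
apply: IH => [|k kn]; last by rewrite sP // ltnW.
by have := size_sub_OPS n s ss; rewrite sn0 scale0r subr0.
Qed.

Lemma OPS_jacobi_matrix : exists J, is_monic_jacobi_matrix P J.
Proof.
have [Pmon Psz Por Pnz] := OPS.
(* The Fourier coefficients of z P_n along P_n and P_(n-1). The default 1 makes [lam 1] nonzero, as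
   the Jacobi matrix requires. *)
pose c n := M ('X * P n.-1 * P n.-1) / M (P n.-1 ^+ 2).
pose lam n := if n.-1 is m.+1 then M (P m.+1 ^+ 2) / M (P m ^+ 2) else 1.
exists (tridiagonal c lam), c, lam; split => [[|n]|n|//].
- by rewrite /lam /= oner_neq0.
- by rewrite /lam /= mulf_neq0 ?invr_eq0 ?Pnz.
pose l := if n is m.+1 then P m else 0.
have sl : (size l <= n)%N by rewrite /l; case: (n) => [|m]; rewrite ?size_poly0 ?Psz.
have sXP k : (size ('X * P k - P k.+1)%R <= k.+1)%N.
  apply: size_sub_monic => //; first by rewrite monicMl ?monicX.
  by rewrite mulrC size_mulX ?Psz // -size_poly_eq0 Psz.
apply/eqP; rewrite -!addrA -subr_eq0 opprD addrA; apply/eqP.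
(* The leading terms cancel, so the defect of the recurrence has degree at most n and is tested
   against P_k for k <= n: k = n fixes [c], k = n - 1 fixes [lam], and smaller k give 0. *)
apply: (OPS_separating n.+1) => [|k].
  have szD (p q : {poly R[i]}) :
      (size p <= n.+1)%N -> (size q <= n.+1)%N -> (size (p + q)%R <= n.+1)%N.
    by move=> ps qs; rewrite (leq_trans (size_polyD _ _)) // geq_max ps.
  apply: (szD _ _ (sXP n)); rewrite size_polyN; apply: szD.
    by rewrite (leq_trans (size_scale_leq _ _)) // Psz.
  by rewrite (leq_trans (size_scale_leq _ _)) // (leq_trans sl).
rewrite ltnS => kn; rewrite -/l mulrBl mulrBl mulrDl -!scalerAl.
rewrite !(linearB M) linearD ![M (_ *: _)]linearZ /= (Por n.+1) ?gtn_eqF ?ltnS // subr0.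
move: kn; rewrite leq_eqVlt => /orP[/eqP->|kn].
  rewrite -expr2 /c /= mulfVK ?Pnz //.
  by rewrite [l * _]mulrC (OPS_orthogonal n n) // mulr0 addr0 subrr.
rewrite (Por n) ?gtn_eqF // mulr0 add0r -mulrA mulrCA.
rewrite /l /lam /= {l sl}; case: n kn => // n kn.
(* z P_k has degree k + 1; for k = n it is monic and equals P_(n+1) up to terms orthogonal to
   P_(n+1). *)
have XPk : M (P n.+1 * ('X * P k)) = (k == n)%:R * M (P n.+1 ^+ 2).
  have [->|kn'] := eqVneq k n; last first.
    rewrite mul0r (OPS_orthogonal n.+1 n.+1) // mulrC size_mulX ?Psz.
      by rewrite ltnS ltn_neqAle kn' -ltnS.
    by rewrite -size_poly_eq0 Psz.
  rewrite -['X * _](subrK (P n.+1)) mulrDr linearD /= mul1r -expr2.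
  by rewrite (OPS_orthogonal n.+1 n.+1) ?add0r.
rewrite XPk; have [->|kn'] := eqVneq k n.
  by rewrite mul1r -expr2 mulfVK ?Pnz // subrr.
by rewrite mul0r (Por n k) 1?eq_sym // mulr0 subrr.
Qed.

End OrthogonalPolynomials.

Lemma OPS_unique {R : realType} {M : {scalar {poly R[i]}}}
    {P Q : nat -> {poly R[i]}} :
  is_monic_OPS M P -> is_monic_OPS M Q -> P =1 Q.
Proof.
move=> OP OQ n; apply/eqP; rewrite -subr_eq0; apply/eqP.
have [Pmon Psz _ _] := OP; have [Qmon Qsz _ _] := OQ.
apply: (OPS_separating OP n) => [|k kn].
  exact: size_sub_monic.
by rewrite mulrBl linearB /= (OPS_orthogonal OP n n) ?(OPS_orthogonal OQ n n) ?Psz ?subrr.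
Qed.

(** * The modified functional and its determinants *)

Lemma christoffel2_is_scalar {R : realType} (L : {scalar {poly R[i]}}) (k1 k2 : R[i]) :
  scalar (christoffel2 L k1 k2).
Proof. by move=> a p q; rewrite /christoffel2 mulrDr -scalerAr linearP. Qed.

HB.instance Definition _ {R : realType} (L : {scalar {poly R[i]}}) (k1 k2 : R[i]) :=
  GRing.isLinear.Build R[i] {poly R[i]} R[i] *%R (christoffel2 L k1 k2)
    (christoffel2_is_scalar L k1 k2).

Lemma monic_OPS_intro {R : realType} {M : {scalar {poly R[i]}}} {Q : nat -> {poly R[i]}} :
  (forall r, r != 0 -> M (r * conjp r) != 0) ->
  (forall n, Q n \is monic) -> (forall n, size (Q n) = n.+1) ->
  (forall n (s : {poly R[i]}), (size s <= n)%N -> M (Q n * s) = 0) -> is_monic_OPS M Q.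
Proof.
move=> Mnz Qmon Qsz Qor; split => // [n m|n].
  by rewrite neq_ltn => /orP[nm|nm]; [rewrite mulrC|]; rewrite Qor ?Qsz.
rewrite expr2 -{2}[Q n](subrK (conjp (Q n))) mulrDr linearD /=.
rewrite (Qor n) ?add0r ?Mnz ?monic_neq0 //.
by apply: size_sub_monic; rewrite ?map_monic ?size_map_poly.
Qed.

Lemma two_roots_factor {F : fieldType} {k1 k2 : F} {p : {poly F}} :
  k1 != k2 -> root p k1 -> root p k2 ->
  exists q, p = ('X - k2%:P) * ('X - k1%:P) * q.
Proof.
move=> k12 r1 r2; have : \prod_(z <- [:: k2; k1]) ('X - z%:P) %| p.
  by apply: uniq_roots_dvdp; rewrite ?uniq_rootsE /= ?r1 ?r2 // inE eq_sym k12.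
by rewrite big_cons big_seq1 => /dvdpP[q ->]; exists q; rewrite mulrC.
Qed.

Lemma shifted_det2 {R : realType} (P : nat -> {poly R[i]}) (a b : R[i]) (n : nat) :
  shifted_det P [tuple a; b] n =
  (P n.+1).[a] * (P n).[b] - (P n).[a] * (P n.+1).[b].
Proof.
rewrite /shifted_det (expand_det_row _ ord0) !big_ord_recl big_ord0 /cofactor.
rewrite !det_mx11 !mxE !(tnth_nth 0) /= /bump /= ?subnn ?subn0 ?addn0 ?addn1.
ring.
Qed.

(** Cofactor expansion along the row of [c]. The middle minor skips the index n + 1, so it is not
    itself a [shifted_det]. *)
Lemma shifted_det3 {R : realType} (P : nat -> {poly R[i]}) (a b c : R[i]) (n : nat) :
  shifted_det P [tuple a; b; c] n =
  shifted_det P [tuple a; b] n * (P n.+2).[c] -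
  ((P n.+2).[a] * (P n).[b] - (P n).[a] * (P n.+2).[b]) * (P n.+1).[c] +
  shifted_det P [tuple a; b] n.+1 * (P n).[c].
Proof.
rewrite !shifted_det2 /shifted_det (expand_det_row _ ord0) !big_ord_recl big_ord0 /cofactor.
rewrite !(expand_det_row _ ord0) !big_ord_recl !big_ord0 /cofactor.
rewrite !det_mx11 !mxE !(tnth_nth 0) /= /bump /= ?subnn ?subn0 ?addn0 ?addn1 ?addn2.
ring.
Qed.

Lemma christoffel2_det_neq0 {R : realType} {L : {scalar {poly R[i]}}}
    {P : nat -> {poly R[i]}} {k1 k2 : R[i]} :
  is_monic_OPS L P -> k1 != k2 ->
  (forall r, r != 0 -> christoffel2 L k1 k2 (r * conjp r) != 0) ->
  forall n, shifted_det P [tuple k1; k2] n != 0.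
Proof.
move=> OPS k12 Mnz n; have [Pmon Psz _ _] := OPS.
(* After transposition the kernel vector [v] combines the columns P_(n+1), P_n, giving a polynomial
   [q] that vanishes at [k1] and [k2]. *)
rewrite /shifted_det -det_tr; apply/det0P => -[v v0 /rowP vA].
pose q := v 0 ord0 *: P n.+1 + v 0 ord_max *: P n.
have rq i : q.[tnth [tuple k1; k2] i] = 0.
  have := vA i; rewrite !mxE !big_ord_recl big_ord0 !mxE addr0 /= addn1 addn0 => <-.
  by rewrite hornerD !hornerZ; congr (_ + v 0 _ * _); apply: val_inj.
have [r qE] := two_roots_factor k12 (introT eqP (rq 0)) (introT eqP (rq 1)).
have sq : (size q <= n.+2)%N.
  rewrite (leq_trans (size_polyD _ _)) // geq_max.
  by rewrite !(leq_trans (size_scale_leq _ _)) ?Psz.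
(* P_(n+1) and P_n have different degrees, hence are linearly independent. *)
have q0 : q != 0.
  apply: contra v0 => /eqP q0.
  have v00 : v 0 ord0 = 0.
    have := congr1 (fun p : {poly R[i]} => p`_n.+1) q0.
    rewrite coefD !coefZ coef0 [(P n)`__]nth_default ?Psz // mulr0 addr0.
    by have := Pmon n.+1; rewrite monicE lead_coefE Psz => /eqP-> ; rewrite mulr1.
  have v01 : v 0 ord_max = 0.
    move: q0; rewrite /q v00 scale0r add0r => /eqP.
    by rewrite scaler_eq0 (negbTE (monic_neq0 (Pmon n))) orbF => /eqP.
  apply/eqP/rowP => i; rewrite mxE; case: i => [[|[|//]] i2].
    by rewrite -[RHS]v00; congr (v 0 _); apply: val_inj.
  by rewrite -[RHS]v01; congr (v 0 _); apply: val_inj.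
have r0 : r != 0 by apply: contraNneq q0 => r0; rewrite qE r0 mulr0.
have sr : (size (conjp r) <= n)%N.
  rewrite size_map_poly; move: sq; rewrite qE -mulrA.
  by rewrite !size_monicM ?monicXsubC ?mulf_neq0 ?polyXsubC_eq0 ?size_XsubC.
(* M[r r^*] = L[q r^*], and [q] lies in the span of P_(n+1) and P_n, both orthogonal to degrees
   below n. *)
have /eqP[] := Mnz r r0.
rewrite /christoffel2 mulrA -qE mulrDl linearD /= -!scalerAl ![L (_ *: _)]linearZ /=.
by rewrite (OPS_orthogonal OPS n.+1 n) ?(OPS_orthogonal OPS n n) // !mulr0 addr0.
Qed.

Theorem theorem3p12 (R : realType)
    (L : {scalar {poly R[i]}})
    (mu : {measure set (measurableTypeR R) -> \bar R})
    (P : nat -> {poly R[i]})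
    (k1 k2 : R[i])
    (L_posdef : positive_definite L)
    (mu_L : represents mu L)
    (P_OPS : is_monic_OPS L P)
    (k12 : (upper_half_plane k1 /\ lower_half_plane k2) \/
           (lower_half_plane k1 /\ upper_half_plane k2)) :
  exists Pss : nat -> {poly R[i]},
    [/\ is_monic_OPS (christoffel2 L k1 k2) Pss /\
        (forall Q : nat -> {poly R[i]},
           is_monic_OPS (christoffel2 L k1 k2) Q -> forall n, Q n = Pss n),
        is_monic_OPS
          (density_functional mu (fun x : R => (x%:C - k1) * (x%:C - k2))) Pss,
        exists J : nat -> nat -> R[i], is_monic_jacobi_matrix Pss J,
        forall n : nat, shifted_det P [tuple k1; k2] n != 0
      & forall (n : nat) (z : R[i]), z != k1 -> z != k2 ->
          (Pss n).[z] =
            1 / ((z - k1) * (z - k2)) *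
            (shifted_det P [tuple k1; k2; z] n / shifted_det P [tuple k1; k2] n)].
Proof.
have [Pmon Psz _ _] := P_OPS.
have Mnz r : r != 0 -> christoffel2 L k1 k2 (r * conjp r) != 0.
  have L_conj := represents_conjp mu_L.
  case: k12 => -[k1H k2H] r0; first exact: christoffel2_norm_neq0.
  (* The weight is symmetric in [k1] and [k2], so the other half-plane case follows by exchanging
     them. *)
  rewrite /christoffel2 [('X - _) * _]mulrC.
  exact: (christoffel2_norm_neq0 L_posdef L_conj k2 k1).
have k1k2 : k1 != k2.
  apply/eqP => k1k2; case: k12; rewrite k1k2 /upper_half_plane /lower_half_plane /=.
    by case=> /lt_trans h /h; rewrite ltxx.
  by case=> /lt_trans h /h; rewrite ltxx.
have Dnz := christoffel2_det_neq0 P_OPS k1k2 Mnz.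
pose w := ('X - k2%:P) * ('X - k1%:P).
have wmon : w \is monic by rewrite monicMl monicXsubC.
have wsz : size w = 3%N by rewrite size_monicM ?monicXsubC ?polyXsubC_eq0 // !size_XsubC.
pose D n := shifted_det P [tuple k1; k2] n.
(* The cofactors of the row of z divided by Delta_n: [P n.+2 + g n] is the determinant quotient as a
   polynomial in z. *)
pose a n := - ((P n.+2).[k1] * (P n).[k2] - (P n).[k1] * (P n.+2).[k2]) / D n.
pose g n := a n *: P n.+1 + (D n.+1 / D n) *: P n.
have NE n z : (P n.+2 + g n).[z] = shifted_det P [tuple k1; k2; z] n / D n.
  rewrite shifted_det3 -/(D n) -/(D n.+1) /g /a !hornerD !hornerZ.
  by field; exact: Dnz.
have gsz n : (size (g n) <= n.+2)%N.
  rewrite (leq_trans (size_polyD _ _)) // geq_max.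
  by rewrite !(leq_trans (size_scale_leq _ _)) ?Psz.
(* At z = k1 or z = k2 two rows of the determinant coincide, so both are roots and the quadratic
   weight divides. *)
have /choice[Q QE] n : exists q, P n.+2 + g n = w * q.
  by apply: two_roots_factor => //; apply/eqP; rewrite NE shifted_det3 !shifted_det2; ring.
have Qmon n : Q n \is monic.
  by rewrite -(monicMl _ wmon) -QE monicE lead_coefDl ?Psz ?ltnS ?gsz -?monicE ?Pmon.
have Qsz n : size (Q n) = n.+1.
  have : size (w * Q n) = n.+3 by rewrite -QE size_polyDl Psz ?ltnS.
  by rewrite size_monicM ?monic_neq0 // wsz => -[].
have QOPS : is_monic_OPS (christoffel2 L k1 k2) Q.
  apply: monic_OPS_intro => // n s ss.
  (* M[Q_n s] = L[(P_(n+2) + g_n) s], a combination of P_(n+2), P_(n+1), P_n paired with degree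
     below n. *)
  rewrite /= /christoffel2 -/w mulrA -QE !mulrDl !linearD /= -!scalerAl.
  rewrite ![L (_ *: _)]linearZ /= (OPS_orthogonal P_OPS n.+2 n) ?leqW //.
  rewrite (OPS_orthogonal P_OPS n.+1 n) ?(OPS_orthogonal P_OPS n n) //.
  by rewrite !mulr0 !addr0.
exists Q; split.
- by split=> // Q' Q'OPS n; exact: (OPS_unique Q'OPS QOPS).
- suff -> : density_functional mu (fun x : R => (x%:C - k1) * (x%:C - k2)) =
            christoffel2 L k1 k2 by [].
  apply/funext => p; rewrite /christoffel2; have [_ ->] := mu_L (w * p).
  rewrite /density_functional; congr complex_integral; apply/funext => x.
  by rewrite /w !hornerM !hornerXsubC; ring.
- exact: OPS_jacobi_matrix QOPS.
- exact: Dnz.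
- move=> n z zk1 zk2; rewrite -/(D n) -NE QE /w !hornerM !hornerXsubC.
  by field; rewrite !subr_eq0 zk1 zk2.
Qed.
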